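(* For every $f\in\mathcal{H}$ we have $\widetilde{S(f)}=\tau\circ\widetilde f\circ\tau$ as linear maps on $\mathcal{A}_r$, where $S$ is the antipode of $\mathcal{H}$.
   Context: Fix $r\ge1$, $\mu_r$ the $r$th roots of unity, $\mathcal{A}_r=\mathbb{Q}\langle x,y_s\mid s\in\mu_r\rangle$ the free noncommutative polynomial algebra over $\mathbb{Q}$. Write $y=y_1$, $z=x+y_1$, $\delta(1)=0$, $\delta(s)=1$ for $s\ne1$, $z_s^\delta=x+\delta(s)y_s$. $\tau$ is the $\mathbb{Q}$-linear anti-automorphism of $\mathcal{A}_r$ with $\tau(x)=y_1$, $\tau(y_1)=x$, $\tau(y_s)=-y_s$ for $s\ne1$. $R_w$ denotes right multiplication by $w$, $R_w^{-1}$ removal of a final factor $w$. Rooted trees: $\mathcal{H}$ is the Connes–Kreimer Hopf algebra over $\mathbb{Q}$: the commutative polynomial algebra on (non-planar) rooted trees, with basis the rooted forests and unit the empty forest $\mathbb{I}$; $\bullet$ is the one-vertex tree. $B_+$ sends a forest to the tree obtained by attaching all its roots to a new root ($B_+(\mathbb{I})=\bullet$). The coproduct $\Delta$ is the algebra map with $\Delta(\mathbb{I})=\mathbb{I}\otimes\mathbb{I}$ and $\Delta(B_+(f))=B_+(f)\otimes\mathbb{I}+(\mathrm{id}\otimes B_+)\Delta(f)$; the counit kills nonempty forests; the antipode $S$ is the algebra anti-automorphism with $m(S\otimes\mathrm{id})\Delta=m(\mathrm{id}\otimes S)\Delta=\mathbb{I}\cdot\varepsilon$. Write $\Delta(f)=\sum_{(f)}f'\otimes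 f''$. Rooted tree maps: $\widetilde{\mathbb{I}}=\mathrm{id}$, and for each forest $f\ne\mathbb{I}$ the linear map $\widetilde{f}:\mathcal{A}_r\to\mathcal{A}_r$ is determined by $\widetilde f(1)=0$ and: (I) $\widetilde{\bullet}(z_s^\delta)=z_s^\delta(z-z_s^\delta)$, $\widetilde{\bullet}(z)=0$; (II) for a forest $f\ne\mathbb{I}$, $\widetilde{B_+(f)}(z_s^\delta)=R_{z-z_s^\delta}R_{2z-z_s^\delta}R_{z-z_s^\delta}^{-1}\widetilde f(z_s^\delta)$ and $\widetilde{B_+(f)}(z)=0$; (III) if $f=gh$, $\widetilde f(v)=\widetilde g(\widetilde h(v))$ for $v\in\{z,z_s^\delta\mid s\in\mu_r\}$; (IV) $\widetilde f(wv)=\sum_{(f)}\widetilde{f'}(w)\widetilde{f''}(v)$ for $w\in\mathcal{A}_r$, $v\in\{z,z_s^\delta\mid s\in\mu_r\}$. These are well defined and $f\mapsto\widetilde f$ extends linearly to an algebra homomorphism $\mathcal{H}\to\mathrm{End}_{\mathbb{Q}}(\mathcal{A}_r)$. *)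

(* Defs.v *)
From HB Require Import structures.
From mathcomp Require Import all_boot all_order all_algebra.
From mathcomp Require Import finmap.
From mathcomp.multinomials Require Import monalg.
Set Implicit Arguments. Unset Strict Implicit. Unset Printing Implicit Defensive.
Import GRing.Theory.
Local Open Scope ring_scope.

Inductive ptree : Type := PNode of seq ptree.

Fixpoint ptree_enc (t : ptree) : GenTree.tree unit :=
  match t with PNode ts => GenTree.Node 0 (map ptree_enc ts) end.
Fixpoint ptree_dec (g : GenTree.tree unit) : ptree :=
  match g with GenTree.Leaf _ => PNode [::] | GenTree.Node _ gs => PNode (map ptree_dec gs) end.
Fixpoint ptree_encK (t : ptree) : ptree_dec (ptree_enc t) = t :=
  match t with PNode ts => f_equal PNode
    ((fix aux (ts : seq ptree) : map ptree_dec (map ptree_enc ts) = ts :=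
      match ts with [::] => erefl | t :: ts => f_equal2 cons (ptree_encK t) (aux ts) end) ts) end.
HB.instance Definition _ := Countable.copy ptree (can_type ptree_encK).

Definition ptle (t1 t2 : ptree) : bool := (choice.pickle t1 <= choice.pickle t2)%N.
Fixpoint canon (t : ptree) : ptree :=
  match t with PNode ts => PNode (sort ptle (map canon ts)) end.
Lemma ptree_ind' (P : ptree -> Prop) :
  (forall ts, (forall t, t \in ts -> P t) -> P (PNode ts)) -> forall t, P t.
Proof.
move=> IH; fix F 1; case=> ts; apply: IH.
elim: ts => [|t0 ts0 IHts] t; first (rewrite in_nil; discriminate).
rewrite inE => /orP[/eqP->|]; [exact: F|exact: IHts].
Qed.
Lemma ptle_total : total ptle.
Proof. by move=> a b; rewrite /ptle leq_total. Qed.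
Lemma ptle_trans : transitive ptle.
Proof. by move=> a b c; rewrite /ptle; apply: leq_trans. Qed.
Lemma canonK (t : ptree) : canon (canon t) == canon t.
Proof.
elim/ptree_ind': t => ts IH /=.
have -> : map canon (sort ptle (map canon ts)) = sort ptle (map canon ts).
  apply: map_id_in => u; rewrite mem_sort => /mapP[t tin ->]; exact/eqP/IH.
by rewrite (sorted_sort ptle_trans (sort_sorted ptle_total _)).
Qed.

(* Non-planar rooted trees: planar trees in canonical form (children    *)
(* recursively sorted).  Forests = finite multisets of non-planar trees *)
(* = monomials of the commutative monoid {cmonom nptree}.               *)
Definition nptree := {t : ptree | canon t == t}.
Definition toNP (t : ptree) : nptree := exist _ (canon t) (canonK t).

Definition forest := {cmonom nptree}.
Definition forest1 : forest := mone.

Definition forest_of (l : seq ptree) : forest :=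
  \big[mmul/forest1]_(t <- l) ucm (toNP t).
Definition trees_of (m : forest) : seq ptree :=
  flatten [seq nseq (m i) (val i) | i <- finsupp m].

Definition Bplus (m : forest) : nptree := toNP (PNode (trees_of m)).
Definition bullet : forest := ucm (Bplus forest1).

(* Connes--Kreimer coproduct in Sweedler form, as the list (with          *)
(* multiplicities) of pairs (f', f''), computed by the defining recursion *)
(* Delta(B_+ f) = B_+ f (x) I + (id (x) B_+) Delta f,  Delta multiplicative. *)
Fixpoint Dtree (t : ptree) : seq (seq ptree * seq ptree) :=
  match t with PNode ts =>
    ([:: PNode ts], [::]) ::
    [seq (p.1, [:: PNode p.2]) | p <-
      (fix DF (ts : seq ptree) : seq (seq ptree * seq ptree) :=
        match ts with
        | [::] => [:: ([::], [::])]
        | t0 :: ts0 => [seq (p.1 ++ q.1, p.2 ++ q.2) | p <- Dtree t0, q <- DF ts0]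
        end) ts]
  end.
Fixpoint Dforest (ts : seq ptree) : seq (seq ptree * seq ptree) :=
  match ts with
  | [::] => [:: ([::], [::])]
  | t0 :: ts0 => [seq (p.1 ++ q.1, p.2 ++ q.2) | p <- Dtree t0, q <- Dforest ts0]
  end.
Definition coprod (m : forest) : seq (forest * forest) :=
  [seq (forest_of p.1, forest_of p.2) | p <- Dforest (trees_of m)].

(* The Connes--Kreimer Hopf algebra H: commutative polynomials over Q in *)
(* the rooted trees; basis: forests.                                     *)
Definition H := {malg rat[forest]}.

(* S is the antipode: m(S (x) id)Delta = m(id (x) S)Delta = I.eps        *)
(* (checked on the basis of forests; S is linear).                       *)
Definition is_antipode (S : {linear H -> H}) : Prop :=
  (forall m : forest,
     \sum_(p <- coprod m) S << p.1 >> * << p.2 >> = ((m == forest1)%:R : H)) /\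
  (forall m : forest,
     \sum_(p <- coprod m) << p.1 >> * S << p.2 >> = ((m == forest1)%:R : H)).

(* A_r = Q<x, y_s | s in mu_r>, r = n.+1.  The r-th roots of unity are  *)
(* indexed by k : 'I_r (s = zeta^k), so s = 1 iff k = 0.                 *)
(* Letters: None = x, Some k = y_{zeta^k}.                               *)
Definition letter (n : nat) := option 'I_n.+1.
Definition A (n : nat) := {malg rat[{fmonom (letter n)}]}.

Definition xA (n : nat) : A n := << fmu (None : letter n) >>.
Definition yA (n : nat) (k : 'I_n.+1) : A n := << fmu (Some k : letter n) >>.
Definition delta (n : nat) (k : 'I_n.+1) : rat := if val k == 0%N then 0 else 1.
Definition zA (n : nat) : A n := xA n + yA ord0.
Definition zdA (n : nat) (k : 'I_n.+1) : A n := xA n + delta k *: yA k.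
Definition zlet (n : nat) (l : letter n) : A n :=
  match l with None => zA n | Some k => zdA k end.

Definition tau_letter (n : nat) (l : letter n) : A n :=
  match l with
  | None => yA ord0
  | Some k => if val k == 0%N then xA n else - yA k
  end.
Definition tau_word (n : nat) (w : {fmonom (letter n)}) : A n :=
  \prod_(l <- rev (fmonom_val w)) tau_letter l.
Definition tau (n : nat) (a : A n) : A n :=
  \sum_(w <- msupp a) a@_w *: tau_word w.

(* Rooted tree maps: a family T f (f a forest) of linear maps on A_r    *)
(* satisfying the defining rules (the paper's tilde f).                  *)
Definition is_RTM (n : nat) (T : forest -> {linear A n -> A n}) : Prop :=
  [/\
      (forall a, T forest1 a = a) /\ (forall m, m != forest1 -> T m 1 = 0),
      (forall k, T bullet (zdA k) = zdA k * (zA n - zdA k)) /\ T bullet (zA n) = 0,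
      (* (II): R_{z-zd} R_{2z-zd} R^{-1}_{z-zd} *)
      (forall m k u, m != forest1 -> T m (zdA k) = u * (zA n - zdA k) ->
          T (ucm (Bplus m)) (zdA k) = u * (2%:R * zA n - zdA k) * (zA n - zdA k)) /\
      (forall m, m != forest1 -> T (ucm (Bplus m)) (zA n) = 0),
      forall g h (l : letter n), T (mmul g h) (zlet l) = T g (T h (zlet l)) &
      forall m w (l : letter n),
        T m (w * zlet l) = \sum_(p <- coprod m) T p.1 w * T p.2 (zlet l)].

Definition Tlin (n : nat) (T : forest -> {linear A n -> A n}) (h : H) (a : A n) : A n :=
  \sum_(m <- msupp h) h@_m *: T m a.

(* Main.v *)
Require Import Defs.
From HB Require Import structures.
From mathcomp Require Import all_boot all_order all_algebra.
From mathcomp Require Import finmap.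
From mathcomp.multinomials Require Import monalg.
Import GRing.Theory.
Local Open Scope ring_scope.

(** Write T_f for the rooted tree map of f, V_f = tau T_f tau, eps for the counit,
    and f', f'' for the Sweedler components of f. The antipode makes T_S a right
    convolution inverse of T, so it is enough that V is a left inverse:
    W_f := sum V_f' T_f'' = eps(f) id. Since T_f(uv) = sum T_f'(u) T_f''(v) and
    V_f(uv) = sum V_f''(u) V_f'(v), this only has to be checked on z, where it is
    clear, and on a = z_s^delta, for which b := z - a = tau(a). Moreover
    W_(fg) = W_f W_g, so f may be taken to be a tree, and W_g = eps(g) id is known
    for all forests g with fewer vertices.

    Write T_f(a) = eps(f) a + phi_f b and psi_f := sum V_f'(phi_f''). Then W_f(a) =
    eps(f) a reads sum psi_f'' V_f'(b) = a tau(phi_f), rule (II) gives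
    psi_(B_+ f) = eps(f) a + psi_f z, and multiplicativity gives
    psi_(fg) = eps(f) psi_g + eps(g) psi_f - psi_g z chi_f where psi_f = a chi_f.
    Hence chi_f is a polynomial in z, which therefore commutes with z:
    sum psi_f'' z V_f'(b) = a z tau(phi_f), and this is W_(B_+ f)(a) = 0.

    Forests are represented by lists of planar trees, on which the coproduct is
    coassociative up to reordering of its terms. *)

(** * The coproduct on lists of planar trees *)

Fixpoint tree_size (t : ptree) : nat :=
  let: PNode ts := t in (sumn (map tree_size ts)).+1.

Definition forest_size (F : seq ptree) : nat := sumn (map tree_size F).

Lemma forest_size_cat (F G : seq ptree) :
  forest_size (F ++ G) = (forest_size F + forest_size G)%N.
Proof. by rewrite /forest_size map_cat sumn_cat. Qed.

Lemma forest_size_tree (F : seq ptree) :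
  forest_size [:: PNode F] = (forest_size F).+1.
Proof. by rewrite /forest_size /= addn0. Qed.

Lemma forest_size_gt0 (t : ptree) (F : seq ptree) : (0 < forest_size (t :: F))%N.
Proof. by rewrite /forest_size /=; case: t. Qed.

Lemma Dtree_node (F : seq ptree) :
  Dtree (PNode F) =
  ([:: PNode F], [::]) :: [seq (p.1, [:: PNode p.2]) | p <- Dforest F].
Proof. by []. Qed.

(** Identities in tensor powers are expressed by summing an arbitrary kernel [K] over the terms of
    the coproduct, so the order of the terms in the lists is immaterial. *)
Section SweedlerSums.
Variable V : nmodType.
Implicit Types (t : ptree) (F G : seq ptree).

Lemma sum_Dforest0 (K : seq ptree -> seq ptree -> V) :
  \sum_(p <- Dforest [::]) K p.1 p.2 = K [::] [::].
Proof. by rewrite big_seq1. Qed.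

Lemma sum_Dforest_cons t F (K : seq ptree -> seq ptree -> V) :
  \sum_(p <- Dforest (t :: F)) K p.1 p.2 =
  \sum_(p <- Dtree t) \sum_(q <- Dforest F) K (p.1 ++ q.1) (p.2 ++ q.2).
Proof. by rewrite /= big_allpairs_dep. Qed.

Lemma sum_Dforest1 t (K : seq ptree -> seq ptree -> V) :
  \sum_(p <- Dforest [:: t]) K p.1 p.2 = \sum_(p <- Dtree t) K p.1 p.2.
Proof.
rewrite sum_Dforest_cons; apply: eq_bigr => p _.
by rewrite (sum_Dforest0 (fun u v => K (p.1 ++ u) (p.2 ++ v))) !cats0.
Qed.

Lemma sum_Dtree F (K : seq ptree -> seq ptree -> V) :
  \sum_(p <- Dtree (PNode F)) K p.1 p.2 =
  K [:: PNode F] [::] + \sum_(p <- Dforest F) K p.1 [:: PNode p.2].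
Proof. by rewrite Dtree_node big_cons big_map. Qed.

Lemma sum_Dforest_tree F (K : seq ptree -> seq ptree -> V) :
  \sum_(p <- Dforest [:: PNode F]) K p.1 p.2 =
  K [:: PNode F] [::] + \sum_(p <- Dforest F) K p.1 [:: PNode p.2].
Proof. by rewrite sum_Dforest1 sum_Dtree. Qed.

Lemma sum_Dforest_cat F G (K : seq ptree -> seq ptree -> V) :
  \sum_(p <- Dforest (F ++ G)) K p.1 p.2 =
  \sum_(p <- Dforest F) \sum_(q <- Dforest G) K (p.1 ++ q.1) (p.2 ++ q.2).
Proof.
elim: F K => [|t F IH] K.
  by rewrite (sum_Dforest0 (fun u v => \sum_(q <- Dforest G) K (u ++ q.1) (v ++ q.2))).
rewrite cat_cons sum_Dforest_cons.
rewrite (sum_Dforest_cons _ _ (fun u v => \sum_(q <- Dforest G) K (u ++ q.1) (v ++ q.2))).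
apply: eq_bigr => p _; rewrite (IH (fun u v => K (p.1 ++ u) (p.2 ++ v))).
by do 2!apply: eq_bigr => ? _; rewrite !catA.
Qed.

End SweedlerSums.

(** Coassociativity. Multiplicativity carries it from trees to forests, and the recursion for B_+
    carries it from the forest of children to a tree. *)
Lemma sum_Dforest_assoc (V : nmodType) (F : seq ptree)
    (K : seq ptree -> seq ptree -> seq ptree -> V) :
  \sum_(p <- Dforest F) \sum_(q <- Dforest p.1) K q.1 q.2 p.2 =
  \sum_(p <- Dforest F) \sum_(q <- Dforest p.2) K p.1 q.1 q.2.
Proof.
pose coass (D : seq (seq ptree * seq ptree)) := forall K,
  \sum_(p <- D) \sum_(q <- Dforest p.1) K q.1 q.2 p.2 =
  \sum_(p <- D) \sum_(q <- Dforest p.2) K p.1 q.1 q.2 :> V.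
(* This serves twice: for the given forest, and for the children inside the tree induction. *)
have coass_cons F0 : (forall t, t \in F0 -> coass (Dtree t)) -> coass (Dforest F0).
  elim: F0 => [|t F0 IH] Ht L; first by rewrite !big_seq1.
  have {}IH := IH (fun u uF => Ht u (@mem_behead _ (t :: F0) u uF)).
  have {}Ht := Ht t (mem_head _ _).
  rewrite (sum_Dforest_cons _ _ _ (fun u v => \sum_(q <- Dforest u) L q.1 q.2 v)).
  rewrite (sum_Dforest_cons _ _ _ (fun u v => \sum_(q <- Dforest v) L u q.1 q.2)).
  under eq_bigr => p _ do under eq_bigr => p' _ do
    rewrite (sum_Dforest_cat _ _ _ (fun u v => L u v (p.2 ++ p'.2))).
  under eq_bigr => p _ do rewrite exchange_big /=.
  under eq_bigr => p _ do under eq_bigr => q _ do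
    rewrite (IH (fun u v w => L (q.1 ++ u) (q.2 ++ v) (p.2 ++ w))).
  rewrite (Ht (fun u v w => \sum_(p' <- Dforest F0) \sum_(q' <- Dforest p'.2)
    L (u ++ p'.1) (v ++ q'.1) (w ++ q'.2))).
  under eq_bigr => p _ do rewrite exchange_big /=.
  apply: eq_bigr => p _; apply: eq_bigr => p' _.
  by rewrite (sum_Dforest_cat _ _ _ (fun u v => L (p.1 ++ p'.1) u v)).
apply: (coass_cons F _ K) => t _ {F K}.
elim/ptree_ind': t => ts IH L.
rewrite (sum_Dtree _ _ (fun u v => \sum_(q <- Dforest u) L q.1 q.2 v)).
rewrite (sum_Dtree _ _ (fun u v => \sum_(q <- Dforest v) L u q.1 q.2)).
rewrite (sum_Dforest_tree _ _ (fun u v => L u v _)) -addrA; congr (_ + _).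
  by rewrite (sum_Dforest0 _ (fun u v => L _ u v)).
under [RHS]eq_bigr => p _ do rewrite (sum_Dforest_tree _ _ (fun u v => L _ u v)).
rewrite big_split /=; congr (_ + _).
exact: (coass_cons ts IH (fun u v w => L u v [:: PNode w])).
Qed.

(** Only the leading term of a tree has an empty second component, so induction on the list
    suffices. *)
Lemma sum_Dforest_counitr (V : nmodType) (F : seq ptree) (K : seq ptree -> V) :
  \sum_(p <- Dforest F) K p.1 *+ nilp p.2 = K F.
Proof.
elim: F K => [|t F IH] K; first by rewrite big_seq1.
rewrite (sum_Dforest_cons _ _ _ (fun u v => K u *+ nilp v)).
case: t => ts; rewrite (sum_Dtree _ _ (fun u v => \sum_(q <- Dforest F)
  K (u ++ q.1) *+ nilp (v ++ q.2))) /=.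
by rewrite (IH (fun u => K (_ :: u))) [X in _ + X]big1 ?addr0 // => p _; rewrite big1.
Qed.

(** Here the leading term of a tree vanishes and the others lead back to its children, hence the
    additional induction on trees. *)
Lemma sum_Dforest_counitl (V : nmodType) (F : seq ptree) (K : seq ptree -> V) :
  \sum_(p <- Dforest F) K p.2 *+ nilp p.1 = K F.
Proof.
pose counit (D : seq (seq ptree * seq ptree)) F := forall K : _ -> V,
  \sum_(p <- D) K p.2 *+ nilp p.1 = K F.
have counit_cons F0 :
    (forall t, t \in F0 -> counit (Dtree t) [:: t]) -> counit (Dforest F0) F0.
  elim: F0 => [|t F0 IH] Ht L; first by rewrite big_seq1.
  have {}IH := IH (fun u uF => Ht u (@mem_behead _ (t :: F0) u uF)).
  have {}Ht := Ht t (mem_head _ _).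
  rewrite (sum_Dforest_cons _ _ _ (fun u v => L v *+ nilp u)).
  rewrite -(IH (fun u => L (t :: u))) exchange_big; apply: eq_bigr => q _ /=.
  rewrite -(Ht (fun u => L (u ++ q.2))) -sumrMnl; apply: eq_bigr => p _.
  by rewrite -mulrnA; case: (p.1) => [|? ?]; rewrite ?mul1n.
apply: (counit_cons F _ K) => t _ {F K}.
elim/ptree_ind': t => ts IH L.
rewrite (sum_Dtree _ _ (fun u v => L v *+ nilp u)) add0r.
exact: (counit_cons ts IH (fun u => L [:: PNode u])).
Qed.

(** The grading by the number of vertices; it bounds the Sweedler components in the inductions on
    size. *)
Lemma Dforest_size (F : seq ptree) (p : seq ptree * seq ptree) :
  p \in Dforest F -> (forest_size p.1 + forest_size p.2)%N = forest_size F.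
Proof.
pose sized (D : seq (seq ptree * seq ptree)) F :=
  forall p, p \in D -> (forest_size p.1 + forest_size p.2)%N = forest_size F.
have sized_cons F0 :
    (forall t, t \in F0 -> sized (Dtree t) [:: t]) -> sized (Dforest F0) F0.
  elim: F0 => [|t F0 IH] Ht q; first by rewrite inE => /eqP ->.
  have {}IH := IH (fun u uF => Ht u (@mem_behead _ (t :: F0) u uF)).
  have {}Ht := Ht t (mem_head _ _).
  case/allpairsPdep => u [v [uD vD ->]] /=.
  rewrite -cat1s !forest_size_cat -(Ht _ uD) -(IH _ vD).
  by rewrite addnACA.
apply: (sized_cons F _ p) => t _ {F p}.
elim/ptree_ind': t => ts IH q; rewrite Dtree_node inE => /predU1P[->|].
  by rewrite addn0.
case/mapP => r rD -> /=.
by rewrite !forest_size_tree addnS (sized_cons ts IH r rD).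
Qed.

(** * Forests as classes of lists of planar trees *)

Lemma forest_of_nil : forest_of [::] = forest1.
Proof. by rewrite /forest_of big_nil. Qed.

Lemma forest_of_cat (F G : seq ptree) :
  forest_of (F ++ G) = mmul (forest_of F) (forest_of G).
Proof. by rewrite /forest_of big_cat. Qed.

Lemma forest_of_seq1 (t : ptree) : forest_of [:: t] = ucm (toNP t).
Proof. by rewrite /forest_of big_seq1. Qed.

Lemma toNP_canon (t : ptree) : toNP (canon t) = toNP t.
Proof. exact/val_inj/eqP/canonK. Qed.

Lemma forest_of_canon (F : seq ptree) : forest_of (map canon F) = forest_of F.
Proof. by rewrite /forest_of big_map; apply: eq_bigr => t _; rewrite toNP_canon. Qed.

Lemma forest_of_perm (F G : seq ptree) : perm_eq F G -> forest_of F = forest_of G.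
Proof. exact: perm_big. Qed.

Lemma forest_ofE (F : seq ptree) (i : nptree) :
  forest_of F i = count_mem (val i) (map canon F).
Proof.
elim: F => [|t F IH] /=; first by rewrite forest_of_nil cm1.
by rewrite -cat1s forest_of_cat cmM IH forest_of_seq1 cmU -val_eqE.
Qed.

Lemma count_trees_of (m : forest) (i : nptree) : count_mem (val i) (trees_of m) = m i.
Proof.
rewrite /trees_of count_flatten -map_comp sumnE big_map.
under eq_bigr => j _ do rewrite /= count_nseq /= val_eqE.
have [im|] := boolP (i \in finsupp m).
  rewrite (big_fsetD1 i) //= eqxx mul1n big1_fset ?addn0 // => j.
  by rewrite !inE => /andP[/negPf->].
rewrite -cmE_eq0 => /eqP mi; rewrite mi big1 // => j _.
by case: eqP => // ->; rewrite mi.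
Qed.

Lemma canon_trees_of (m : forest) : map canon (trees_of m) = trees_of m.
Proof.
apply: map_id_in => t /flattenP[s /mapP[i _ ->]] /nseqP[-> _].
exact/eqP/(valP i).
Qed.

Lemma perm_trees_of (F : seq ptree) :
  perm_eq (trees_of (forest_of F)) (map canon F).
Proof.
(* A tree that is not canonical occurs in neither list, so only elements of [nptree] have to be
   counted. *)
have nc G t : canon t != t -> count_mem t (map canon G) = 0%N.
  by move=> ct; apply/count_memPn/mapP => -[u _ tu]; rewrite tu canonK in ct.
apply/allP => t _ /=; apply/eqP.
case: (boolP (canon t == t)) => ct; last by rewrite -canon_trees_of !nc.
by rewrite (count_trees_of _ (exist _ t ct)) forest_ofE.
Qed.

Lemma trees_ofK (m : forest) : forest_of (trees_of m) = m.
Proof. by apply/eqP/cmP => i; rewrite forest_ofE canon_trees_of count_trees_of. Qed.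

Lemma forest_of_eq1 (F : seq ptree) : (forest_of F == forest1) = nilp F.
Proof.
case: F => [|t F]; first by rewrite forest_of_nil eqxx.
by rewrite -cat1s forest_of_cat cmM_eq1 forest_of_seq1 cm1_eq1.
Qed.

Lemma Bplus_forest_of (F : seq ptree) : Bplus (forest_of F) = toNP (PNode F).
Proof.
apply: val_inj => /=; congr PNode; rewrite canon_trees_of.
(* Sorting depends only on the multiset because [ptle] is antisymmetric, [choice.pickle] being
   injective. *)
apply/perm_sortP; [exact: ptle_total|exact: ptle_trans| |exact: perm_trees_of].
by move=> u v; rewrite /ptle -eqn_leq => /eqP/(pcan_inj choice.pickleK).
Qed.

Lemma forest_of_tree (F : seq ptree) :
  forest_of [:: PNode F] = ucm (Bplus (forest_of F)).
Proof. by rewrite forest_of_seq1 Bplus_forest_of. Qed.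

Section CoproductInvariance.
Variable V : nmodType.
Implicit Types (F G : seq ptree) (K : forest -> forest -> V).

Let Dsum F K := \sum_(p <- Dforest F) K (forest_of p.1) (forest_of p.2).

Let Dsum_cat F G K :
  Dsum (F ++ G) K = Dsum F (fun u v => Dsum G (fun u' v' => K (mmul u u') (mmul v v'))).
Proof.
rewrite /Dsum (sum_Dforest_cat _ _ _ (fun u v => K (forest_of u) (forest_of v))).
by do 2!apply: eq_bigr => ? _; rewrite !forest_of_cat.
Qed.

(** Permutations are generated by exchanges of blocks, and for these the commutativity of the
    product of forests suffices. *)
Lemma sum_Dforest_perm F G K : perm_eq F G ->
  \sum_(p <- Dforest F) K (forest_of p.1) (forest_of p.2) =
  \sum_(p <- Dforest G) K (forest_of p.1) (forest_of p.2).
Proof.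
move=> FG; rewrite -!/(Dsum _ K).
apply: (@catCA_perm_ind _ (fun G => Dsum F K = Dsum G K)) FG _ => // s1 s2 s3 ->.
rewrite !catA !(Dsum_cat (_ ++ _)) !Dsum_cat /Dsum exchange_big /=.
by do 3!apply: eq_bigr => ? _; congr K; rewrite (mulmC (forest_of _) (forest_of _)).
Qed.

Lemma sum_Dforest_canon F K :
  \sum_(p <- Dforest (map canon F)) K (forest_of p.1) (forest_of p.2) =
  \sum_(p <- Dforest F) K (forest_of p.1) (forest_of p.2).
Proof.
have IHF F0 : (forall t, t \in F0 -> forall L, Dsum [:: canon t] L = Dsum [:: t] L) ->
    forall L, Dsum (map canon F0) L = Dsum F0 L.
  elim: F0 => [|t F0 IH] Ht L //.
  rewrite /= -cat1s -[t :: F0]cat1s !Dsum_cat Ht ?mem_head //.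
  by apply: eq_bigr => p _; apply: IH => u uF; apply: Ht; rewrite inE uF orbT.
rewrite -!/(Dsum _ K); apply: (IHF F _ K) => t _ {F K}.
elim/ptree_ind': t => ts IH L; rewrite /Dsum /=.
rewrite !(sum_Dforest_tree _ _ (fun u v => L (forest_of u) (forest_of v))).
rewrite !forest_of_tree forest_of_nil.
have eqf : forest_of (sort ptle (map canon ts)) = forest_of ts.
  by rewrite -(forest_of_canon ts); apply: forest_of_perm; rewrite perm_sort.
rewrite eqf; congr (_ + _).
under eq_bigr => p _ do rewrite forest_of_tree.
under [RHS]eq_bigr => p _ do rewrite forest_of_tree.
pose L' u v := L u (ucm (Bplus v)).
rewrite -/(Dsum _ L') -[RHS]/(Dsum _ L') -(IHF ts IH).
by apply: sum_Dforest_perm; rewrite perm_sort.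
Qed.

(** Links [coprod], which works on the representative [trees_of], to [Dforest] on an arbitrary
    one. *)
Lemma sum_coprod F K :
  \sum_(p <- coprod (forest_of F)) K p.1 p.2 =
  \sum_(p <- Dforest F) K (forest_of p.1) (forest_of p.2).
Proof.
rewrite /coprod big_map -(sum_Dforest_canon F).
exact/sum_Dforest_perm/perm_trees_of.
Qed.

End CoproductInvariance.

(** * The convolution inverse of a family of rooted tree maps *)

Definition conj_map {R : pzRingType} {B : lalgType R} (tau f : {linear B -> B}) : {linear B -> B} :=
  (tau \o (f \o tau))%FUN.
Arguments conj_map : simpl never.

(** The setting is an abstract algebra with a family [T] indexed by lists of planar trees, so that
    recursion on lists is available. The index [k] stands for the root of unity. *)
Section ConvolutionInverse.
Variables (R : pzRingType) (B : lalgType R) (I : Type) (z : B) (a : I -> B).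
Variables (tau : {linear B -> B}) (T : seq ptree -> {linear B -> B}).
Variable phi : I -> seq ptree -> B.

Local Notation b k := (z - a k).
Local Notation V F := (conj_map tau (T F)).

Hypothesis gen_ind : forall P : B -> Prop, P 1 ->
  (forall u v, P u -> P v -> P (u + v)) -> (forall c u, P u -> P (c *: u)) ->
  (forall u, P u -> P (u * z)) -> (forall u k, P u -> P (u * a k)) -> forall u, P u.
Hypothesis b_cancel : forall k u v, u * b k = v * b k -> u = v.
Hypothesis tauM : forall u v : B, tau (u * v) = tau v * tau u.
Hypothesis tauK : forall u, tau (tau u) = u.
Hypothesis tau_z : tau z = z.
Hypothesis tau_a : forall k, tau (a k) = b k.
Hypothesis T_nil : forall u, T [::] u = u.
Hypothesis T_one : forall F, T F 1 = 1 *+ nilp F.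
Hypothesis T_cat : forall F G u, T (F ++ G) u = T F (T G u).
Hypothesis T_catC : forall F G u, T (F ++ G) u = T (G ++ F) u.
Hypothesis T_mul : forall F (u v : B),
  T F (u * v) = \sum_(p <- Dforest F) T p.1 u * T p.2 v.
Hypothesis T_z : forall F, T F z = z *+ nilp F.
Hypothesis T_a : forall k F, T F (a k) = a k *+ nilp F + phi k F * b k.
Hypothesis phi_nil : forall k, phi k [::] = 0.
Hypothesis phi_tree : forall k F,
  phi k [:: PNode F] = a k *+ nilp F + phi k F * (z + b k).

Lemma conj_mapE F u : V F u = tau (T F (tau u)). Proof. by []. Qed.

Lemma conj_map_nil u : V [::] u = u.
Proof. by rewrite conj_mapE T_nil tauK. Qed.

Lemma conj_map_cat F G u : V (F ++ G) u = V F (V G u).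
Proof. by rewrite !conj_mapE T_cat tauK. Qed.

Lemma conj_map_comm F G u : V F (V G u) = V G (V F u).
Proof. by rewrite -!conj_map_cat !conj_mapE T_catC. Qed.

Lemma conj_map_mul F u v :
  V F (u * v) = \sum_(p <- Dforest F) V p.2 u * V p.1 v.
Proof.
rewrite conj_mapE tauM T_mul linear_sum.
by apply: eq_bigr => p _; rewrite tauM.
Qed.

Lemma conj_map_z F : V F z = z *+ nilp F.
Proof. by rewrite conj_mapE tau_z T_z linearMn /= tau_z. Qed.

Lemma conj_map_mulz F u : V F (u * z) = V F u * z.
Proof.
rewrite conj_map_mul -(sum_Dforest_counitl _ F (fun G => V G u * z)).
by apply: eq_bigr => p _; rewrite conj_map_z mulrnAr.
Qed.

Lemma tau_b k : tau (b k) = a k.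
Proof. by rewrite -tau_a tauK. Qed.

Lemma conj_map_b k F : V F (b k) = b k *+ nilp F + a k * tau (phi k F).
Proof. by rewrite conj_mapE tau_b T_a linearD linearMn /= tau_a tauM tau_b. Qed.

Lemma conj_map_a k F : V F (a k) = a k *+ nilp F - a k * tau (phi k F).
Proof.
have {1}-> : a k = z - b k by rewrite opprB addrC subrK.
by rewrite linearB conj_map_b conj_map_z opprD addrA -mulrnBl opprB (addrC z) subrK.
Qed.

Lemma T_b k F : T F (b k) = b k *+ nilp F - phi k F * b k.
Proof. by rewrite linearB /= T_z T_a opprD addrA mulrnBl. Qed.

(** Expand [T F (T G (a k))] by [T_a], [T_mul] and [T_b], then cancel the final factor [b k]. The
    subtracted sum comes from the sign in [T_b]. *)
Lemma phi_cat k F G : phi k (F ++ G) = phi k F *+ nilp G +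
  (T F (phi k G) - \sum_(p <- Dforest F) T p.1 (phi k G) * phi k p.2).
Proof.
apply: (b_cancel k); apply: (addrI (a k *+ nilp (F ++ G))).
rewrite -T_a T_cat [in T G _]T_a linearD linearMn /= T_a T_mul.
under [X in _ + X = _]eq_bigr => p _ do rewrite T_b mulrDr mulrnAr mulrN mulrA.
rewrite big_split /= (sum_Dforest_counitr _ F (fun G0 => T G0 (phi k G) * b k)).
rewrite sumrN -mulr_suml -mulrBl mulrnDl -mulrnAl -addrA -mulrDl.
by case: F G => [|t F] [|u G] /=; rewrite ?mulr1n ?mulr0n.
Qed.

(** * Convolution with the conjugated family *)

Let W F u := \sum_(p <- Dforest F) V p.1 (T p.2 u).
Let unital F := forall u, W F u = u *+ nilp F.
Let psi k F := \sum_(p <- Dforest F) V p.1 (phi k p.2).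

(** Since [V] reverses Sweedler components on products, the second and third components meet in the
    left factor, and coassociativity turns them into a convolution. *)
Lemma sum_conj_map_mulr F (g : seq ptree -> B) v :
  \sum_(p <- Dforest F) V p.1 (g p.2 * v) =
  \sum_(p <- Dforest F) (\sum_(q <- Dforest p.2) V q.1 (g q.2)) * V p.1 v.
Proof.
under eq_bigr => p _ do rewrite conj_map_mul.
rewrite (sum_Dforest_assoc _ _ (fun x y w => V y (g w) * V x v)).
by apply: eq_bigr => p _; rewrite mulr_suml.
Qed.

(** Of four Sweedler components, the second and third meet as [W] applied to [u], which collapses to
    the counit. *)
Lemma sum_conj_map_mull n F (g : seq ptree -> B) u :
    (forall G, forest_size G <= n -> W G u = u *+ nilp G)%N ->
    (forest_size F <= n)%N ->
  \sum_(p <- Dforest F) V p.1 (\sum_(q <- Dforest p.2) T q.1 u * g q.2) =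
  u * \sum_(p <- Dforest F) V p.1 (g p.2).
Proof.
move=> Wn leFn; under eq_bigr => p _ do rewrite linear_sum.
rewrite -(sum_Dforest_assoc _ _ (fun x y w => V x (T y u * g w))).
under eq_bigr => p _ do rewrite (sum_conj_map_mulr _ (fun y => T y u)).
rewrite (sum_Dforest_assoc _ _ (fun x y w => W y u * V x (g w))) mulr_sumr.
rewrite !big_seq; apply: eq_bigr => p pF.
rewrite -(sum_Dforest_counitl _ p.2 (fun w => u * V p.1 (g w))) big_seq [RHS]big_seq.
apply: eq_bigr => q qp; rewrite Wn ?mulrnAl // (leq_trans _ leFn) //.
rewrite -(Dforest_size _ _ pF) -(Dforest_size _ _ qp).
exact: leq_trans (leq_addr _ _) (leq_addl _ _).
Qed.

(** This is [W F (a k) = a k *+ nilp F] expanded by [T_a]: the first summand of [T_a] contributes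
    [V F (a k)]. By [conj_map_a] the right side is [a k * tau (phi k F)]. *)
Lemma sum_psi_conj_map_b k F : unital F ->
  \sum_(p <- Dforest F) psi k p.2 * V p.1 (b k) = a k *+ nilp F - V F (a k).
Proof.
move=> WF; rewrite -(sum_conj_map_mulr _ (phi k)) -WF /W.
rewrite -(sum_Dforest_counitr _ F (fun G => V G (a k))) -sumrB.
by apply: eq_bigr => p _; rewrite T_a linearD linearMn [RHS]addrC addKr.
Qed.

Lemma psi_nil k : psi k [::] = 0.
Proof. by rewrite /psi big_seq1 phi_nil linear0. Qed.

Lemma psi_treeE k F :
  psi k [:: PNode F] = \sum_(p <- Dforest F) V p.1 (phi k [:: PNode p.2]).
Proof.
by rewrite /psi (sum_Dforest_tree _ _ (fun u v => V u (phi k v))) phi_nil linear0 add0r.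
Qed.

(** In [phi_tree] the term [a k] contributes [V F (a k)], which cancels against the contribution of
    [phi k F * b k]. *)
Lemma psi_tree k F : unital F ->
  psi k [:: PNode F] = a k *+ nilp F + psi k F * z.
Proof.
move=> WF; rewrite psi_treeE.
under eq_bigr => p _ do rewrite phi_tree mulrDr !linearD linearMn conj_map_mulz.
rewrite !big_split /= -mulr_suml (sum_Dforest_counitr _ F (fun G => V G (a k))).
rewrite (sum_conj_map_mulr _ (phi k)) (sum_psi_conj_map_b k _ WF).
by rewrite addrC -addrA subrK addrC.
Qed.

(* The properties of the elements of Q[z] that the argument uses. *)
Let zpoly c := c * z = z * c /\ forall F u, V F (u * c) = V F u * c.

(** The three terms of [phi_cat] give [e1], [e2] and [e3], and the two occurrences of
    [V G (a k) * c] cancel. *)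
Lemma psi_cat k F G c : zpoly c -> psi k F = a k * c ->
    (forall F', forest_size F' <= forest_size F -> unital F')%N -> unital G ->
  psi k (F ++ G) = psi k G *+ nilp F + psi k F *+ nilp G - psi k G * z * c.
Proof.
move=> [_ cV] psiF WF WG.
have e1 : \sum_(p <- Dforest F) \sum_(q <- Dforest G)
    V (p.1 ++ q.1) (phi k p.2 *+ nilp q.2) = V G (a k) * c.
  rewrite -cV -psiF linear_sum; apply: eq_bigr => p _.
  rewrite -(sum_Dforest_counitr _ G (fun x => V x (V p.1 (phi k p.2)))).
  by apply: eq_bigr => q _; rewrite conj_map_cat !linearMn conj_map_comm.
have e2 : \sum_(p <- Dforest F) \sum_(q <- Dforest G)
    V (p.1 ++ q.1) (T p.2 (phi k q.2)) = psi k G *+ nilp F.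
  rewrite exchange_big -sumrMnl; apply: eq_bigr => q _.
  rewrite -linearMn -WF // linear_sum; apply: eq_bigr => p _.
  by rewrite conj_map_cat conj_map_comm.
(* The sum over [F] collapses to [phi k q.2 * psi k F]. Then [psi k F = a k * c] and [a k = z - b k]
   reduce the sum over [G] to [sum_psi_conj_map_b]. *)
have e3 : \sum_(p <- Dforest F) \sum_(q <- Dforest G)
    V (p.1 ++ q.1) (\sum_(r <- Dforest p.2) T r.1 (phi k q.2) * phi k r.2) =
    (psi k G * z - (a k *+ nilp G - V G (a k))) * c.
  rewrite exchange_big.
  transitivity (\sum_(q <- Dforest G) V q.1 (phi k q.2 * psi k F)).
    apply: eq_bigr => q _.
    rewrite -(@sum_conj_map_mull (forest_size F) _ (phi k)) => [|F' leF'|//].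
      by rewrite linear_sum; apply: eq_bigr => p _; rewrite conj_map_cat conj_map_comm.
    exact: WF.
  rewrite (sum_conj_map_mulr _ (phi k)) psiF -(sum_psi_conj_map_b k _ WG).
  rewrite -(sum_Dforest_counitl _ G (fun x => psi k x * z)) -sumrB mulr_suml.
  apply: eq_bigr => p _; rewrite cV mulrA -mulrnAr -conj_map_z -mulrBr -linearB.
  by rewrite opprB addrC subrK.
have -> : psi k (F ++ G) =
    V G (a k) * c + (psi k G *+ nilp F - (psi k G * z - (a k *+ nilp G - V G (a k))) * c).
  rewrite -e1 -e2 -e3 -sumrB -big_split /psi.
  rewrite (sum_Dforest_cat _ _ _ (fun u v => V u (phi k v))); apply: eq_bigr => p _.
  rewrite -sumrB -big_split; apply: eq_bigr => q _.
  by rewrite phi_cat linearD linearB.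
rewrite psiF !mulrBl mulrnAl opprB addrCA; set v := V G (a k) * c.
by rewrite [v + _]addrA (addrC v) subrK addrA.
Qed.

(** Induction on size: [psi_tree] handles a single tree, [psi_cat] a head tree followed by a
    nonempty rest. *)
Lemma psi_zpoly n : (forall F, forest_size F <= n -> unital F)%N ->
  forall k F, (forest_size F <= n)%N -> exists2 c, zpoly c & psi k F = a k * c.
Proof.
move=> Wn k F; move: {2}(forest_size F).+1 (ltnSn (forest_size F)) => m.
elim: m F => // m IH [|[ts] F] lem len.
  exists 0; last by rewrite psi_nil mulr0.
  by split=> [|F u]; rewrite ?mulr0 ?mul0r // linear0.
have tree_case : exists2 c, zpoly c & psi k [:: PNode ts] = a k * c.
  have ts_lt : (forest_size ts < forest_size (PNode ts :: F))%N.
    by rewrite -cat1s forest_size_cat forest_size_tree ltnS leq_addr.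
  have [||c [cz cV] psits] := IH ts.
  - exact: leq_trans ts_lt lem.
  - exact: leq_trans (ltnW ts_lt) len.
  (* Read off from [psi_tree] by factoring out [a k] on the left. *)
  exists (1 *+ nilp ts + c * z).
    split=> [|G u]; first by rewrite mulrDl mulrDr mulrnAl mulrnAr mul1r mulr1 mulrA -cz.
    by rewrite !mulrDr linearD mulrnAr mulrnAr !mulr1 linearMn mulrA conj_map_mulz cV mulrA.
  rewrite psi_tree ?psits; first by rewrite mulrDr mulrnAr mulr1 mulrA.
  by apply: Wn; apply: leq_trans (ltnW ts_lt) len.
case: F lem len => // t F lem len.
have F_lt : (forest_size (t :: F) < forest_size (PNode ts :: t :: F))%N.
  by rewrite -(cat1s (PNode ts)) forest_size_cat -[ltnLHS]add0n ltn_add2r forest_size_gt0.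
have t_le : (forest_size [:: PNode ts] <= forest_size (PNode ts :: t :: F))%N.
  by rewrite -(cat1s _ (t :: F)) forest_size_cat leq_addr.
have [||d [dz dV] psiF] := IH (t :: F).
- exact: leq_trans F_lt lem.
- exact: leq_trans (ltnW F_lt) len.
have [c [cz cV] psit] := tree_case.
(* Both factors are nonempty, so only the last term of [psi_cat] survives. *)
exists (- (d * z * c)).
  split=> [|G u].
    by rewrite mulrN mulNr -!mulrA cz !mulrA dz.
  by rewrite !mulrN linearN !mulrA cV conj_map_mulz dV.
rewrite -(cat1s (PNode ts)) (@psi_cat _ _ _ c) //.
- by rewrite !mulr0n !add0r psiF mulrN !mulrA.
- by move=> G leG; apply: Wn; apply: leq_trans leG (leq_trans t_le len).
by apply: Wn; apply: leq_trans (ltnW F_lt) len.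
Qed.

Lemma a_cancel k u v : a k * u = a k * v -> u = v.
Proof.
move=> /(congr1 tau); rewrite !tauM tau_a => /b_cancel /(congr1 tau).
by rewrite !tauK.
Qed.

Lemma unital_tree_a n k F : (forall G, forest_size G <= n -> unital G)%N ->
  (forest_size F <= n)%N -> W [:: PNode F] (a k) = 0.
Proof.
move=> Wn leFn; have WF := Wn _ leFn.
rewrite /W (sum_Dforest_tree _ _ (fun u v => V u (T v (a k)))) T_nil.
under eq_bigr => p _ do rewrite T_a mulr0n add0r.
rewrite (sum_conj_map_mulr _ (fun x => phi k [:: PNode x])).
have psi_c p : p \in Dforest F -> exists2 c, zpoly c & psi k p.2 = a k * c.
  move=> pF; apply: psi_zpoly Wn _ _ _; apply: leq_trans leFn.
  by rewrite -(Dforest_size _ _ pF) leq_addl.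
(* With [psi k p.2 = a k * c], the witness is the sum of the [c * V p.1 (b k)]; the factor [z] moves
   to the left of each [c] because they commute. *)
have [xi xi1 xi2] : exists2 xi,
    \sum_(p <- Dforest F) psi k p.2 * V p.1 (b k) = a k * xi &
    \sum_(p <- Dforest F) psi k p.2 * z * V p.1 (b k) = a k * z * xi.
  rewrite !big_seq.
  elim/big_rec2: _ => [|p y1 y2 /psi_c[c [cz _] psip] [xi -> ->]].
    by exists 0; rewrite !mulr0.
  exists (c * V p.1 (b k) + xi); rewrite psip !mulrDr !mulrA //.
  by rewrite -(mulrA (a k) c z) cz mulrA.
have -> : \sum_(p <- Dforest F)
    (\sum_(q <- Dforest p.2) V q.1 (phi k [:: PNode q.2])) * V p.1 (b k) =
    a k * V F (b k) + a k * z * xi.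
  rewrite -xi2 -(sum_Dforest_counitr _ F (fun x => a k * V x (b k))) -big_split.
  rewrite !big_seq; apply: eq_bigr => p pF; rewrite -psi_treeE psi_tree.
    by rewrite mulrDl mulrnAl.
  by apply: Wn; apply: leq_trans leFn; rewrite -(Dforest_size _ _ pF) leq_addl.
(* The known identity for [F] determines [xi] after cancelling [a k]. *)
have -> : xi = tau (phi k F).
  apply: (@a_cancel k); rewrite -xi1 sum_psi_conj_map_b // conj_map_a.
  by rewrite opprB addrC subrK.
rewrite conj_map_a mulr0n add0r conj_map_b phi_tree linearD linearMn tauM linearD.
rewrite tau_a tau_b tau_z !mulrDr mulrDl !mulrDr mulrnAr !mulrA.
set x := _ *+ _; set y := a k * z * _; set w := a k * a k * _.
by rewrite -(addrA x) (addrC w) addNr.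
Qed.

Lemma W_mul n F u v : (forall G, forest_size G <= n -> W G u = u *+ nilp G)%N ->
  (forest_size F <= n)%N -> W F (u * v) = u * W F v.
Proof.
move=> Wu leFn; rewrite /W.
under eq_bigr => p _ do rewrite T_mul.
exact: (sum_conj_map_mull _ _ (fun x => T x v) _ Wu leFn).
Qed.

Lemma W_cat F G u : unital F -> W (F ++ G) u = W G u *+ nilp F.
Proof.
move=> WF; rewrite /W (sum_Dforest_cat _ _ _ (fun x y => V x (T y u))) exchange_big.
rewrite -sumrMnl; apply: eq_bigr => q _; rewrite -linearMn -WF linear_sum.
by apply: eq_bigr => p _; rewrite conj_map_cat T_cat conj_map_comm.
Qed.

Lemma conj_map_convolution F u :
  \sum_(p <- Dforest F) conj_map tau (T p.1) (T p.2 u) = u *+ nilp F.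
Proof.
rewrite -/(W F u); suff: forall n G, (forest_size G <= n)%N -> unital G by apply.
move=> {F u}; elim=> [|n IH] F leFn.
  case: F leFn => [|t F]; last by rewrite leqNgt forest_size_gt0.
  by move=> _ u; rewrite /W big_seq1 T_nil conj_map_nil.
(* A single tree has children of size at most [n]. With several trees, the head alone has size at
   most [n], so [W_cat] applies. *)
have Wa k G : (forest_size G <= n.+1)%N -> W G (a k) = a k *+ nilp G.
  case: G => [|[ts] G] leG; first by rewrite /W big_seq1 T_nil conj_map_nil.
  move: leG; case: G => [|t G].
    by rewrite forest_size_tree ltnS => lets; rewrite (unital_tree_a _ _ _ IH lets).
  rewrite -(cat1s (PNode ts)) forest_size_cat => leG.
  rewrite W_cat ?mulr0n //; apply: IH; rewrite -ltnS; apply: leq_trans leG.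
  by rewrite -[ltnLHS]addn0 ltn_add2l forest_size_gt0.
have Wz G : W G z = z *+ nilp G.
  rewrite -conj_map_z -(sum_Dforest_counitr _ G (fun x => V x z)).
  by apply: eq_bigr => p _; rewrite T_z linearMn.
(* An involutive anti-multiplicative map fixes the unit: tau 1 = tau 1 * tau (tau 1) = tau (tau 1) =
   1. *)
have tau1 : tau 1 = 1 by rewrite -[LHS]mulr1 -{2}(tauK 1) -tauM mulr1 tauK.
have W1 G : W G 1 = 1 *+ nilp G.
  have <- : V G 1 = 1 *+ nilp G by rewrite conj_mapE tau1 T_one linearMn /= tau1.
  rewrite -(sum_Dforest_counitr _ G (fun x => V x 1)).
  by apply: eq_bigr => p _; rewrite T_one linearMn.
(* The forest stays universally quantified, since [W_mul] needs the hypothesis on [u] for every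
   forest within the size bound. *)
move=> u; move: u F leFn.
apply: gen_ind => [//|u v IHu IHv F leF|c u IHu F leF|u IHu F leF|u k IHu F leF].
- rewrite mulrnDl -IHu // -IHv // -big_split.
  by apply: eq_bigr => p _; rewrite !linearD.
- rewrite scalerMnr -IHu // scaler_sumr.
  by apply: eq_bigr => p _; rewrite !linearZ.
- by rewrite (W_mul _ _ _ _ IHu leF) Wz mulrnAr.
by rewrite (W_mul _ _ _ _ IHu leF) Wa // mulrnAr.
Qed.

End ConvolutionInverse.

(** * Linear maps on monoid algebras *)

Section MalgExtension.
Variables (K : choiceType) (R : nzRingType).

Lemma malgUZ (c : R) (k : K) : << c *g k >> = c *: << k >> :> {malg R[K]}.
Proof. by apply/malgP => j; rewrite mcoeffZ !mcoeffU mulrnAr mulr1. Qed.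

Lemma malg_ind (P : {malg R[K]} -> Prop) :
  (forall u v, P u -> P v -> P (u + v)) -> (forall c u, P u -> P (c *: u)) ->
  P 0 -> (forall k, P << k >>) -> forall u, P u.
Proof.
move=> PD PZ P0 PU u; rewrite [u]monalgE.
by apply: big_ind => // k _; rewrite malgUZ; apply: PZ.
Qed.

Variables (V : lmodType R) (E : K -> V).

(** Has the shape of [tau] and [Tlin], which become linear maps by conversion. *)
Definition malg_ext (g : {malg R[K]}) : V := \sum_(k <- msupp g) g@_k *: E k.

Lemma malg_extEw (d : {fset K}) (g : {malg R[K]}) :
  (msupp g `<=` d)%fset -> malg_ext g = \sum_(k <- d) g@_k *: E k.
Proof.
move=> le; rewrite [LHS](big_fset_incl _ le) => //= k _ /mcoeff_outdom ->.
by rewrite scale0r.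
Qed.

Lemma malg_ext_is_linear : linear malg_ext.
Proof.
move=> c u v; pose d := (msupp u `|` msupp v)%fset.
have leu : (msupp u `<=` d)%fset by apply: fsubsetUl.
have lev : (msupp v `<=` d)%fset by apply: fsubsetUr.
rewrite (@malg_extEw d (c *: u + v)); last first.
  apply: fsubset_trans (msuppD_le _ _) _; rewrite fsubUset lev andbT.
  exact: fsubset_trans (msuppZ_le _ _) leu.
rewrite (malg_extEw _ _ leu) (malg_extEw _ _ lev) scaler_sumr -big_split.
by apply: eq_bigr => k _; rewrite /= mcoeffD mcoeffZ scalerDl scalerA.
Qed.

HB.instance Definition _ := GRing.isLinear.Build R {malg R[K]} V *:%R malg_ext
  malg_ext_is_linear.

Lemma malg_extU (k : K) : malg_ext << k >> = E k.
Proof. by rewrite (malg_extEw _ _ msuppU_le) big_seq_fset1 mcoeffUU scale1r. Qed.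

End MalgExtension.

Lemma malgUM (K : monomType) (R : nzRingType) (k l : K) :
  << k >> * << l >> = << mmul k l >> :> {malg R[K]}.
Proof. by rewrite malgM_def fgmulUU mulr1. Qed.

Lemma malg_scaleAr (K : monomType) (R : comNzRingType) (c : R) (u v : {malg R[K]}) :
  u * (c *: v) = c *: (u * v).
Proof.
apply/malgP => k; rewrite mcoeffZ [in RHS]mcoeffMl.
rewrite (mcoeffMlw _ (fsubset_refl _) (msuppZ_le c v)) mulr_sumr.
apply: eq_bigr => i _; rewrite mulr_sumr; apply: eq_bigr => j _.
by rewrite mcoeffZ mulrCA mulrnAr.
Qed.

(** * The anti-automorphism and the removal of a final letter *)

Section FreeAlgebra.
Variable n : nat.
Local Notation z := (zA n).
Local Notation a k := (@zdA n k).
Local Notation letterA l := (<< fmu (l : letter n) >> : A n).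

Lemma zdA0 : a ord0 = xA n.
Proof. by rewrite /zdA /delta /= scale0r addr0. Qed.

Lemma word_rcons (s : seq (letter n)) (l : letter n) :
  << FMonom (rcons s l) >> = << FMonom s >> * letterA l :> A n.
Proof. by rewrite malgUM /mmul /= fmmulE fmU /= cats1. Qed.

(** Every letter is a combination of the generators: x = z_1^delta, y_1 = z - z_1^delta, and y_s =
    z_s^delta - z_1^delta for s different from 1. *)
Lemma A_ind (P : A n -> Prop) : P 1 ->
  (forall u v, P u -> P v -> P (u + v)) -> (forall c u, P u -> P (c *: u)) ->
  (forall u (l : letter n), P u -> P (u * zlet l)) -> forall u, P u.
Proof.
move=> P1 PD PZ PM; have P0 : P 0 by rewrite -(scale0r (1 : A n)); apply: PZ.
have PB u v : P u -> P v -> P (u - v).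
  by move=> Pu Pv; apply: PD => //; rewrite -scaleN1r; apply: PZ.
apply: malg_ind => // -[s]; elim/last_ind: s => [|s l Ps].
  by rewrite -fmoneE.
rewrite word_rcons; case: l => [k|]; last first.
  by rewrite -/(xA n) -zdA0; apply: (PM _ (Some ord0)).
have [->|k0] := eqVneq k ord0.
  have -> : letterA (Some ord0) = zlet None - zlet (Some ord0).
    by rewrite /= zdA0 /zA addrC addKr.
  by rewrite mulrBr; apply: PB; apply: PM.
have -> : letterA (Some k) = zlet (Some k) - zlet (Some ord0).
  by rewrite /= zdA0 /zdA /delta -[val k == _]/(k == ord0) (negPf k0) scale1r addrC addKr.
by rewrite mulrBr; apply: PB; apply: PM.
Qed.

Definition tau_linear : {linear A n -> A n} := malg_ext _ _ _ (@tau_word n).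

Lemma tau_linearE (u : A n) : tau u = tau_linear u. Proof. by []. Qed.

Lemma tau_wordE (w : {fmonom (letter n)}) : tau_linear << w >> = tau_word w.
Proof. exact: malg_extU. Qed.

Lemma tau_letterE (l : letter n) : tau_linear (letterA l) = tau_letter l.
Proof. by rewrite tau_wordE /tau_word fmU big_seq1. Qed.

Lemma tau_mul (u v : A n) : tau_linear (u * v) = tau_linear v * tau_linear u.
Proof.
elim/malg_ind: u => [u u' IH IH'|c u IH||w].
- by rewrite mulrDl !linearD mulrDr IH IH'.
- by rewrite -scalerAl !linearZ /= IH malg_scaleAr.
- by rewrite mul0r !linear0 mulr0.
elim/malg_ind: v => [v v' IH IH'|c v IH||w'].
- by rewrite mulrDr !linearD mulrDl IH IH'.
- by rewrite malg_scaleAr !linearZ /= IH -scalerAl.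
- by rewrite mulr0 !linear0 mul0r.
by rewrite malgUM !tau_wordE /tau_word fmM rev_cat big_cat.
Qed.

Lemma tau_one : tau_linear 1 = 1.
Proof. by rewrite tau_wordE /tau_word fm1 big_nil. Qed.

Lemma tau_zA : tau_linear z = z.
Proof. by rewrite linearD !tau_letterE /= addrC. Qed.

Lemma tau_zdA k : tau_linear (a k) = z - a k.
Proof.
rewrite /zdA linearD linearZ /= !tau_letterE /= /delta.
case: eqP => _; first by rewrite !scale0r !addr0 /zA addrC addKr.
by rewrite !scale1r /zA opprD addrA [xA n + _]addrC addrK.
Qed.

Lemma tau_invol (u : A n) : tau_linear (tau_linear u) = u.
Proof.
elim/A_ind: u => [|u v IH IH'|c u IH|u l IH]; first by rewrite !tau_one.
- by rewrite !linearD IH IH'.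
- by rewrite !linearZ /= IH.
rewrite !tau_mul IH; congr (_ * _); case: l => [k|] /=; last by rewrite !tau_zA.
by rewrite tau_zdA linearB /= tau_zA tau_zdA opprB addrC subrK.
Qed.

(** Removes a final y_1 and kills all other words. As z - z_s^delta = y_1 - delta(s) y_s, this one
    map inverts right multiplication by z - z_s^delta for every s. *)
Definition strip_word (w : {fmonom (letter n)}) : A n :=
  if rev w is l :: s then if l == Some ord0 then << FMonom (rev s) >> else 0 else 0.

Definition strip : {linear A n -> A n} := malg_ext _ _ _ strip_word.

Lemma strip_wordE (w : {fmonom (letter n)}) : strip << w >> = strip_word w.
Proof. exact: malg_extU. Qed.

Lemma strip_letter (u : A n) (l : letter n) :
  strip (u * letterA l) = if l == Some ord0 then u else 0.
Proof.
elim/malg_ind: u => [u v IH IH'|c u IH||w].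
- by rewrite mulrDl linearD IH IH'; case: ifP => // _; rewrite addr0.
- by rewrite -scalerAl linearZ /= IH; case: ifP => // _; rewrite scaler0.
- by rewrite mul0r linear0 if_same.
rewrite malgUM strip_wordE /strip_word fmM fmU cats1 rev_rcons.
by case: ifP => // _; rewrite revK fmK.
Qed.

Lemma strip_mul (u : A n) k : strip (u * (z - a k)) = u.
Proof.
rewrite /zA /zdA opprD addrACA subrr add0r mulrBr malg_scaleAr linearB linearZ /=.
rewrite !strip_letter /= /delta -[val k == _]/(Some k == Some ord0).
by case: eqP => _; rewrite ?scale0r ?scaler0 subr0.
Qed.

Lemma strip_zdA k : strip (a k) = 0.
Proof.
rewrite -[a k]mul1r /zdA mulrDr malg_scaleAr linearD linearZ /=.
rewrite !strip_letter /= /delta -[val k == _]/(Some k == Some ord0).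
by case: eqP => _; rewrite ?scale0r ?scaler0 addr0.
Qed.

End FreeAlgebra.

(** * Rooted tree maps *)

Section RootedTreeMaps.
Variables (n : nat) (T : forest -> {linear A n -> A n}).
Hypothesis rtmT : is_RTM T.
Local Notation z := (zA n).
Local Notation a k := (@zdA n k).
Local Notation TF F := (T (forest_of F)).

Lemma RTM_nil u : TF [::] u = u.
Proof. by case: rtmT => -[T1 _] *; rewrite forest_of_nil T1. Qed.

Lemma RTM_one F : TF F 1 = 1 *+ nilp F.
Proof.
case: rtmT => -[T1 T0] *; rewrite -forest_of_eq1.
by case: eqP => [->|/eqP F0]; [rewrite T1|rewrite T0].
Qed.

Lemma RTM_cat_letter F G (l : letter n) :
  TF (F ++ G) (zlet l) = TF F (TF G (zlet l)).
Proof. by case: rtmT => _ _ _ TM _; rewrite forest_of_cat TM. Qed.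

Lemma RTM_mul_letter F u (l : letter n) :
  TF F (u * zlet l) = \sum_(p <- Dforest F) TF p.1 u * TF p.2 (zlet l).
Proof.
case: rtmT => _ _ _ _ TL.
by rewrite TL (sum_coprod _ _ (fun f g => T f u * T g (zlet l))).
Qed.

(** Extends rule (IV) from a final generator to any right factor; coassociativity regroups the
    components. *)
Lemma RTM_mul F u v : TF F (u * v) = \sum_(p <- Dforest F) TF p.1 u * TF p.2 v.
Proof.
elim/A_ind: v F => [|v v' IH IH'|c v IH|v l IH] F.
- rewrite mulr1 -(sum_Dforest_counitr _ F (fun G => TF G u)).
  by apply: eq_bigr => p _; rewrite RTM_one mulrnAr mulr1.
- rewrite mulrDr linearD IH IH' -big_split.
  by apply: eq_bigr => p _; rewrite linearD mulrDr.
- rewrite malg_scaleAr linearZ /= IH scaler_sumr.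
  by apply: eq_bigr => p _; rewrite linearZ /= malg_scaleAr.
rewrite mulrA RTM_mul_letter.
transitivity (\sum_(p <- Dforest F) \sum_(q <- Dforest p.1)
    TF q.1 u * TF q.2 v * TF p.2 (zlet l)).
  by apply: eq_bigr => p _; rewrite IH mulr_suml.
rewrite (sum_Dforest_assoc _ _ (fun f g h => TF f u * TF g v * TF h (zlet l))).
apply: eq_bigr => p _; rewrite RTM_mul_letter mulr_sumr.
by apply: eq_bigr => q _; rewrite mulrA.
Qed.

(** Extends rule (III) from generators to all elements, using the product rule for both maps. *)
Lemma RTM_cat F G u : TF (F ++ G) u = TF F (TF G u).
Proof.
elim/A_ind: u F G => [|u v IH IH'|c u IH|u l IH] F G.
- by rewrite !RTM_one linearMn /= RTM_one -mulrnA; case: F G => [|? ?] [|? ?].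
- by rewrite !linearD IH IH'.
- by rewrite !linearZ /= IH.
rewrite !RTM_mul_letter linear_sum.
rewrite (sum_Dforest_cat _ _ _ (fun f g => TF f u * TF g (zlet l))) exchange_big.
apply: eq_bigr => q _; rewrite RTM_mul.
by apply: eq_bigr => p _; rewrite IH RTM_cat_letter.
Qed.

Lemma RTM_catC F G u : TF (F ++ G) u = TF (G ++ F) u.
Proof. by rewrite !forest_of_cat mulmC. Qed.

Lemma RTM_z F : TF F z = z *+ nilp F.
Proof.
elim: F => [|[ts] F IH]; first by rewrite RTM_nil.
rewrite -cat1s RTM_cat IH; case: F {IH} => [|t F]; last by rewrite linear0.
rewrite forest_of_tree; case: rtmT => _ [_ Tz0] [_ Tz] _ _.
(* The tree over the empty forest is [bullet], which falls under rule (I) instead of (II). *)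
have [->|ts1] := eqVneq (forest_of ts) forest1; first exact: Tz0.
exact: Tz.
Qed.

Lemma RTM_bullet k : TF [:: PNode [::]] (a k) = a k * (z - a k).
Proof. by case: rtmT => _ [Ta _] *; rewrite forest_of_tree forest_of_nil Ta. Qed.

Lemma RTM_tree k F u : ~~ nilp F -> TF F (a k) = u * (z - a k) ->
  TF [:: PNode F] (a k) = u * (z + (z - a k)) * (z - a k).
Proof.
rewrite -forest_of_eq1 => F1 TFa; case: rtmT => _ _ [Ta _] _ _.
have -> : z + (z - a k) = 2%:R * z - a k by rewrite mulr_natl mulr2n addrA.
by rewrite forest_of_tree; apply: Ta.
Qed.

Lemma RTM_zB k F : ~~ nilp F -> TF F (a k) = - TF F (z - a k).
Proof. by case: F => // t F _; rewrite linearB /= RTM_z sub0r opprK. Qed.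

(** Rule (II) presupposes a right factor z - a, so its presence must be proved. The claim concerns
    the image of z - a rather than of a because it then also holds for the empty forest, which
    occurs among the components of the product rule. *)
Lemma RTM_divisible k F : exists u, TF F (z - a k) = u * (z - a k).
Proof.
move: {2}(forest_size F).+1 (ltnSn (forest_size F)) => m.
elim: m F => // m IH [|[ts] F] leF; first by exists 1; rewrite RTM_nil mul1r.
move: leF; case: F => [|t F].
  rewrite forest_size_tree ltnS => /IH[u tsu].
  have opp v : TF [:: PNode ts] (a k) = v * (z - a k) ->
      exists u, TF [:: PNode ts] (z - a k) = u * (z - a k).
    by move=> tv; exists (- v); rewrite mulNr -tv (RTM_zB k [:: PNode ts] isT) opprK.
  case: ts tsu opp => [|t ts] tsu opp; first exact: opp (RTM_bullet k).
  have tsa : TF (t :: ts) (a k) = - u * (z - a k) by rewrite (RTM_zB k (t :: ts) isT) tsu mulNr.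
  exact: opp (RTM_tree k (t :: ts) _ isT tsa).
rewrite -(cat1s _ (t :: F)) forest_size_cat ltnS => leF.
have [|u Fu] := IH (t :: F).
  by apply: leq_trans leF; rewrite -[ltnLHS]add0n ltn_add2r forest_size_gt0.
rewrite RTM_cat Fu RTM_mul big_seq.
elim/big_rec: _ => [|p v pD [w ->]]; first by exists 0; rewrite mul0r.
have [|x ->] := IH p.2.
  apply: leq_trans leF; rewrite (leq_ltn_trans (n := forest_size [:: PNode ts])) //.
    by rewrite -(Dforest_size _ _ pD) leq_addl.
  by rewrite -[ltnLHS]addn0 ltn_add2l forest_size_gt0.
by exists (TF p.1 u * x + w); rewrite mulrDl mulrA.
Qed.

Definition RTM_quotient k F : A n := strip n (TF F (a k)).
Local Notation phi := RTM_quotient.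

Lemma RTM_quotientE k F : TF F (a k) = a k *+ nilp F + phi k F * (z - a k).
Proof.
rewrite /phi; case: F => [|t F]; first by rewrite RTM_nil strip_zdA mul0r addr0.
have [u tFu] := RTM_divisible k (t :: F).
by rewrite add0r (RTM_zB k (t :: F) isT) tFu -mulNr strip_mul.
Qed.

Lemma RTM_quotient_nil k : phi k [::] = 0.
Proof. by rewrite /phi RTM_nil strip_zdA. Qed.

Lemma RTM_quotient_tree k F :
  phi k [:: PNode F] = a k *+ nilp F + phi k F * (z + (z - a k)).
Proof.
case: F => [|t F]; first by rewrite RTM_quotient_nil mul0r addr0 /phi RTM_bullet strip_mul.
by rewrite add0r {1}/phi (@RTM_tree _ _ (phi k (t :: F))) ?strip_mul // RTM_quotientE add0r.
Qed.

Lemma RTM_convolution F u :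
  \sum_(p <- Dforest F) conj_map (tau_linear n) (TF p.1) (TF p.2 u) = u *+ nilp F.
Proof.
apply: (@conj_map_convolution _ _ _ z (fun k => a k) (tau_linear n)
  (fun F => TF F) RTM_quotient).
- move=> P P1 PD PZ Pz Pa; apply: A_ind => // v [k|]; [exact: Pa|exact: Pz].
- by move=> k v w eqvw; rewrite -(strip_mul _ v k) eqvw strip_mul.
- exact: tau_mul.
- exact: tau_invol.
- exact: tau_zA.
- exact: tau_zdA.
- exact: RTM_nil.
- exact: RTM_one.
- exact: RTM_cat.
- exact: RTM_catC.
- exact: RTM_mul.
- exact: RTM_z.
- exact: RTM_quotientE.
- exact: RTM_quotient_nil.
exact: RTM_quotient_tree.
Qed.

(** * Linear extension to the Hopf algebra and the antipode *)

Definition Tlin_linear u : {linear H -> A n} := malg_ext _ _ _ (fun m => T m u).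

Lemma TlinD h h' u : Tlin T (h + h') u = Tlin T h u + Tlin T h' u.
Proof. exact: (linearD (Tlin_linear u)). Qed.

Lemma TlinZ c h u : Tlin T (c *: h) u = c *: Tlin T h u.
Proof. exact: (linearZZ (Tlin_linear u)). Qed.

Lemma Tlin0 u : Tlin T 0 u = 0.
Proof. exact: (linear0 (Tlin_linear u)). Qed.

Lemma TlinU m u : Tlin T << m >> u = T m u.
Proof. exact: malg_extU. Qed.

Lemma Tlin_mulU m h u : Tlin T (<< m >> * h) u = T m (Tlin T h u).
Proof.
elim/malg_ind: h => [h h' IH IH'|c h IH||m'].
- rewrite mulrDr TlinD (TlinD h) (linearD (T m)).
  exact: (f_equal2 _ IH IH').
- have -> : << m >> * (c *: h) = c *: (<< m >> * h) :> H by exact: malg_scaleAr.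
  (* Plain rewriting would unfold the operations of the monoid algebra when it
     compares two different elements, and not terminate in practice. *)
  apply: etrans (TlinZ _ _ _) _; apply: etrans (f_equal (GRing.scale c) IH) _.
  by apply/esym; apply: etrans (f_equal (T m) (TlinZ _ _ _)) _; apply: linearZZ.
- by rewrite mulr0 Tlin0 (linear0 (T m)).
rewrite malgUM; apply: etrans (TlinU _ _) _; rewrite TlinU.
by have := RTM_cat (trees_of m) (trees_of m') u; rewrite forest_of_cat !trees_ofK.
Qed.

Variable S : {linear H -> H}.
Hypothesis antipodeS : is_antipode S.

(** Apply the linear map sending [h] to [Tlin T h u] to the identity m(id (x) S)Delta = I.eps;
    products become composites by [Tlin_mulU]. *)
Lemma RTM_antipode F u :
  \sum_(p <- Dforest F) TF p.1 (Tlin T (S << forest_of p.2 >>) u) = u *+ nilp F.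
Proof.
case: antipodeS => _ /(_ (forest_of F)).
rewrite (sum_coprod _ _ (fun f g => << f >> * S << g >>)) forest_of_eq1.
move/(congr1 (Tlin_linear u)).
rewrite (linear_sum (Tlin_linear u)) (linearMn (Tlin_linear u)) => eqS.
transitivity (Tlin_linear u 1 *+ nilp F).
  by rewrite -eqS; apply: eq_bigr => p _; rewrite -Tlin_mulU.
congr (_ *+ _); rewrite -[RHS]RTM_nil forest_of_nil; exact: TlinU.
Qed.

(* Both families are convolution inverses of [TF], one on each side. *)
Lemma Tlin_antipode F u :
  Tlin T (S << forest_of F >>) u = conj_map (tau_linear n) (TF F) u.
Proof.
rewrite -(sum_Dforest_counitr _ F (fun G => conj_map (tau_linear n) (TF G) u)).
under eq_bigr => p _ do rewrite -linearMn -RTM_antipode linear_sum.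
rewrite -(sum_Dforest_assoc _ _ (fun f g h =>
  conj_map (tau_linear n) (TF f) (TF g (Tlin T (S << forest_of h >>) u)))).
under eq_bigr => p _ do rewrite RTM_convolution.
by rewrite (sum_Dforest_counitl _ F (fun G => Tlin T (S << forest_of G >>) u)).
Qed.

End RootedTreeMaps.

Theorem mainTheorem4 (n : nat) (T : forest -> {linear A n -> A n})
  (S : {linear H -> H}) :
  is_RTM T -> is_antipode S ->
  forall (h : H) (a : A n), Tlin T (S h) a = tau (Tlin T h (tau a)).
Proof.
move=> rtmT antipodeS h a; rewrite !tau_linearE.
elim/malg_ind: h => [h h' IH IH'|c h IH||m].
- by rewrite (linearD S) !TlinD linearD IH IH'.
- rewrite (linearZZ S); apply: etrans (TlinZ _ _ _ _ _) _.
  apply: etrans (f_equal (GRing.scale c) IH) _; apply/esym.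
  by apply: etrans (f_equal (tau_linear n) (TlinZ _ _ _ _ _)) _; apply: linearZZ.
- by rewrite (linear0 S) !Tlin0 linear0.
by rewrite TlinU -(trees_ofK m) (Tlin_antipode _ _ rtmT _ antipodeS).
Qed.
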